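(* Let $\mathcal{O}=\{t_1,\dots,t_\mu\}$ be an order ideal in $\mathbb{T}^n$ with border $\partial\mathcal{O}=\{b_1,\dots,b_\nu\}$, and let $\Phi:K[c_{ij}]\to C_{\mathcal{O}}$ be the surjective $K$-algebra homomorphism defined by $\Phi(c_{ij})=\Delta_{ij}/\Delta_{\mathcal{O}}$ ($i=1,\dots,\mu$, $j=1,\dots,\nu$). (a) The ideal $\ker(\Phi)$ is the vanishing ideal of the principal component $\mathbb{C}_{\mathcal{O}}$ of the border basis scheme $\mathbb{B}_{\mathcal{O}}$. In particular, the principal component $\mathbb{C}_{\mathcal{O}}$ of $\mathbb{B}_{\mathcal{O}}$ is the closure of the image of the morphism $\mathrm{Spec}(C_{\mathcal{O}})\hookrightarrow\mathbb{B}_{\mathcal{O}}$ induced by $\Phi$. (b) The scheme $\mathbb{C}_{\mathcal{O}}$ is irreducible.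
   Context: $K$ is a field with algebraic closure $\overline{K}$, $P=K[x_1,\dots,x_n]$, $\overline{P}=\overline{K}[x_1,\dots,x_n]$, and $\mathbb{T}^n$ is the monoid of terms. An order ideal is a finite nonempty set $\mathcal{O}\subset\mathbb{T}^n$ closed under forming divisors, with border $\partial\mathcal{O}=(x_1\mathcal{O}\cup\cdots\cup x_n\mathcal{O})\setminus\mathcal{O}$. An ideal $I$ has an $\mathcal{O}$-border basis if the residue classes of the elements of $\mathcal{O}$ form a vector space basis of the quotient ring modulo $I$; the border basis is then $\{b_j-\sum_i\gamma_{ij}t_i\}_j\subset I$ with unique scalars $\gamma_{ij}$. Border basis scheme: let $c_{ij}$ ($1\le i\le\mu$, $1\le j\le\nu$) be indeterminates. For $1\le k\le n$ let $\mathcal{A}_k$ be the $\mu\times\mu$ matrix whose $m$-th column is the $i$-th standard basis vector if $x_kt_m=t_i$, and $(c_{1j},\dots,c_{\mu j})^{\rm tr}$ if $x_kt_m=b_j$. Let $I(\mathbb{B}_{\mathcal{O}})\subset K[c_{ij}]$ be generated by the entries of all commutators $\mathcal{A}_k\mathcal{A}_\ell-\mathcal{A}_\ell\mathcal{A}_k$. Then $\mathbb{B}_{\mathcal{O}}=\mathrm{Spec}(K[c_{ij}]/I(\mathbb{B}_{\mathcal{O}}))$; its $\overline{K}$-rational points $(\gamma_{ij})$ correspond bijectively to the ideals $I\subset\overline{P}$ having an $\mathcal{O}$-border basis, where $\gamma_{ij}$ are the coefficients of the border basis of $I$; write $\beta(I)$ for the point of $\mathbb{B}_{\mathcal{O}}\times_{\mathrm{Spec}(K)}\mathrm{Spec}(\overline{K})$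 corresponding to $I$. Principal component: $\mathbb{C}_{\mathcal{O}}$ is the closed subscheme of $\mathbb{B}_{\mathcal{O}}$ such that $\mathbb{C}_{\mathcal{O}}\times_{\mathrm{Spec}(K)}\mathrm{Spec}(\overline{K})$ is the closure (with its reduced structure) of the set of all points $\beta(I_{\mathbb{X}})$, where $\mathbb{X}\subseteq\mathbb{A}^n(\overline{K})$ is a reduced scheme of length $\mu$ whose vanishing ideal $I_{\mathbb{X}}\subset\overline{P}$ has an $\mathcal{O}$-border basis. The ring $C_{\mathcal{O}}$: let $Q=K[y_k^{(i)}\mid i=1,\dots,\mu,\ k=1,\dots,n]$ be a polynomial ring, $\mathbf{y}^{(i)}=(y_1^{(i)},\dots,y_n^{(i)})$, and for a term $t$ let $t(\mathbf{y}^{(i)})$ be the result of substituting $x_k\mapsto y_k^{(i)}$ in $t$. Put $\Delta_{\mathcal{O}}=\det\bigl(t_j(\mathbf{y}^{(i)})\bigr)_{i,j=1,\dots,\mu}$, which is a nonzero element of $Q$. For $1\le i\le\mu$, $1\le j\le\nu$, let $\Delta_{ij}\in Q$ be the determinant of the matrix obtained from $\bigl(t_j(\mathbf{y}^{(i)})\bigr)_{i,j}$ by replacing its $i$-th column by $(b_j(\mathbf{y}^{(1)}),\dots,b_j(\mathbf{y}^{(\mu)}))^{\rm tr}$. $C_{\mathcal{O}}$ is the $K$-subalgebra of the quotient field of $Q$ generated by all $\Delta_{ij}/\Delta_{\mathcal{O}}$. The defining ideal $I(\mathbb{B}_{\mathcal{O}})$ is contained in $\ker(\Phi)$, so $\Phi$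 induces a closed immersion $\mathrm{Spec}(C_{\mathcal{O}})\hookrightarrow\mathbb{B}_{\mathcal{O}}$. *)

(* Defs.v *)
From HB Require Import structures.
From mathcomp Require Import all_boot all_algebra all_field.
From mathcomp Require Import boolp classical_sets topology_structure.
From mathcomp Require Import mpoly.

Set Implicit Arguments.
Unset Strict Implicit.
Unset Printing Implicit Defensive.

Import GRing.Theory.

Local Open Scope classical_set_scope.
Local Open Scope ring_scope.

Definition is_ideal (A : comNzRingType) (I : set A) : Prop :=
  [/\ I 0, forall f g, I f -> I g -> I (f + g)
    & forall a f, I f -> I (a * f)].

Definition is_prime_ideal (A : comNzRingType) (I : set A) : Prop :=
  [/\ is_ideal I, ~ I 1 & forall f g, I (f * g) -> I f \/ I g].

Definition ideal_gen (A : comNzRingType) (E : set A) : set A :=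
  [set f | exists (r : nat) (a g : 'I_r -> A),
     (forall s, E (g s)) /\ f = \sum_(s < r) a s * g s].

Lemma ideal_gen_ideal (A : comNzRingType) (E : set A) :
  is_ideal (ideal_gen E).
Proof.
split=> [|f f'|c f].
- exists 0%N, (fun _ => 0), (fun _ => 0); split=> [[] //|].
  by rewrite big_ord0.
- move=> [r [a [g [Eg ->]]]] [r' [a' [g' [Eg' ->]]]].
  pose glue (u : 'I_r -> A) (v : 'I_r' -> A) (s : 'I_(r + r')) :=
    match split s with inl i => u i | inr i => v i end.
  exists (r + r')%N, (glue a a'), (glue g g'); split.
    by move=> s; rewrite /glue; case: splitP.
  rewrite big_split_ord /=; congr (_ + _); apply: eq_bigr => i _.
    by rewrite /glue (unsplitK (inl i)).
  by rewrite /glue (unsplitK (inr i)).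
- move=> [r [a [g [Eg ->]]]].
  exists r, (fun s => c * a s), g; split=> //.
  by rewrite mulr_sumr; apply: eq_bigr => s _; rewrite mulrA.
Qed.

Record Spec (A : comNzRingType) := MkSpec {
  spec_ideal : set A;
  spec_idealP : is_prime_ideal spec_ideal }.

HB.instance Definition _ (A : comNzRingType) := gen_eqMixin (Spec A).
HB.instance Definition _ (A : comNzRingType) := gen_choiceMixin (Spec A).

Definition zero_locus (A : comNzRingType) (E : set A) : set (Spec A) :=
  [set p : Spec A | E `<=` spec_ideal p].

Definition vanishing_ideal (A : comNzRingType) (Z : set (Spec A)) : set A :=
  [set f | forall p : Spec A, Z p -> spec_ideal p f].

Definition zariski_open (A : comNzRingType) : set_system (Spec A) :=
  [set U | exists E : set A, U = ~` zero_locus E].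

Lemma zariski_openT (A : comNzRingType) : zariski_open [set: Spec A].
Proof.
exists setT; apply/seteqP; split=> // p _ Tp.
by have [_ + _] := spec_idealP p; apply; apply: Tp.
Qed.

Lemma zariski_openI (A : comNzRingType) : setI_closed (@zariski_open A).
Proof.
move=> _ _ [E ->] [F ->].
exists [set h | exists f g, [/\ E f, F g & h = f * g]].
apply/seteqP; split=> p /=.
  move=> [nE nF] pEF.
  have /existsNP[f /not_implyP[Ef npf]] := nE.
  have /existsNP[g /not_implyP[Fg npg]] := nF.
  have [_ _ pP] := spec_idealP p.
  by have [] := pP f g (pEF _ (ex_intro _ f (ex_intro _ g (And3 Ef Fg erefl)))).
have [[_ _ pM] _ _] := spec_idealP p.
move=> nEF; split=> pE; apply: nEF => _ [f [g [Ef Fg ->]]].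
  by rewrite mulrC; apply: pM; apply: pE.
by apply: pM; apply: pE.
Qed.

Lemma zariski_open_bigU (A : comNzRingType) (I : Type)
    (U : I -> set (Spec A)) :
  (forall i, zariski_open (U i)) -> zariski_open (\bigcup_i U i).
Proof.
move=> Uo; have [E UE] := choice Uo.
exists (\bigcup_i E i); apply/seteqP; split=> p.
  move=> [i _]; rewrite UE => npE pE; apply: npE => f Ef.
  by apply: pE; exists i.
move=> /existsNP[f /not_implyP[[i _ Eif] npf]].
by exists i => //; rewrite UE => pE; apply: npf; apply: pE.
Qed.

HB.instance Definition _ (A : comNzRingType) :=
  isOpenTopological.Build (Spec A)
    (@zariski_openT A) (@zariski_openI A) (@zariski_open_bigU A).

Lemma preimage_prime (A B : comNzRingType) (phi : {rmorphism A -> B})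
  (p : Spec B) : is_prime_ideal (phi @^-1` spec_ideal p).
Proof.
have [[p0 pD pM] p1 pP] := spec_idealP p; split; rewrite /preimage /=.
- by split=> [|f g|a f] /=; rewrite ?rmorph0 ?rmorphD ?rmorphM; auto.
- by rewrite rmorph1.
- by move=> f g; rewrite rmorphM; apply: pP.
Qed.

Definition spec_map (A B : comNzRingType) (phi : {rmorphism A -> B})
  (p : Spec B) : Spec A := MkSpec (preimage_prime phi p).

Lemma zero_prime (F : fieldType) : is_prime_ideal [set 0 : F].
Proof.
split=> [||f g /eqP] /=.
- split=> //= [f g -> ->|a f ->]; by rewrite ?addr0 ?mulr0.
- by move/eqP; rewrite oner_eq0.
- by rewrite mulf_eq0 => /orP[] /eqP; [left | right].
Qed.

Definition spec_field_point (F : fieldType) : Spec F := MkSpec (zero_prime F).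

(** The closed subschemes of [Spec A] are the [Spec (A / I)], for [I] an ideal
    of [A]; such a subscheme is represented by [I]. *)
Record closed_subscheme (A : comNzRingType) := MkClosed {
  def_ideal : set A;
  def_idealP : is_ideal def_ideal }.

Lemma closed_subscheme_eq (A : comNzRingType) (X Y : closed_subscheme A) :
  def_ideal X = def_ideal Y -> X = Y.
Proof.
case: X Y => I iI [J iJ] /= IJ; case: J / IJ iJ => iJ.
by congr MkClosed; apply: Prop_irrelevance.
Qed.

Definition points (A : comNzRingType) (X : closed_subscheme A) :
  set (Spec A) := zero_locus (def_ideal X).

Definition subscheme (A : comNzRingType) (X Y : closed_subscheme A) : Prop :=
  def_ideal Y `<=` def_ideal X.

(** Absence of nilpotents in [A / I]. *)
Definition reduced (A : comNzRingType) (X : closed_subscheme A) : Prop :=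
  forall (f : A) (k : nat), def_ideal X (f ^+ k) -> def_ideal X f.

Lemma vanishing_ideal_ideal (A : comNzRingType) (Z : set (Spec A)) :
  is_ideal (vanishing_ideal Z).
Proof.
split=> [p _|f g If Ig p Zp|a f If p Zp];
  have [[p0 pD pM] _ _] := spec_idealP p => //.
- by apply: pD; [apply: If | apply: Ig].
- by apply: pM; apply: If.
Qed.

(** The closure of a set of points, with its reduced structure. *)
Definition reduced_closure (A : comNzRingType) (S : set (Spec A)) :
    closed_subscheme A :=
  MkClosed (vanishing_ideal_ideal (closure S)).

(** For [X = Spec (A / I)], the scheme [X x_(Spec A) Spec B = Spec (B / I B)].
    When [A = K[c]], [B = L[c]] and [phi] extends [K -> L], this is also
    [X x_(Spec K) Spec L]. *)
Definition base_change (A B : comNzRingType) (phi : {rmorphism A -> B})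
    (X : closed_subscheme A) : closed_subscheme B :=
  MkClosed (ideal_gen_ideal (phi @` def_ideal X)).

(** For the subspace topology on [S], whose closed sets are the traces of the
    closed sets of [T]. *)
Definition irreducible_set (T : topologicalType) (S : set T) : Prop :=
  S !=set0 /\
  forall F G : set T, closed F -> closed G ->
    S `<=` F `|` G -> S `<=` F \/ S `<=` G.

Definition is_order_ideal (n mu : nat) (t : mu.-tuple 'X_{1..n}) : Prop :=
  [/\ (0 < mu)%N, uniq t
    & forall m m' : 'X_{1..n}, m \in t -> (m' <= m)%MM -> m' \in t].

Definition is_border (n mu nu : nat) (t : mu.-tuple 'X_{1..n})
    (b : nu.-tuple 'X_{1..n}) : Prop :=
  uniq b /\
  forall m : 'X_{1..n}, m \in b <->
    (exists (k : 'I_n) (m' : 'X_{1..n}), m' \in t /\ m = (U_(k) + m')%MM)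
    /\ m \notin t.

Definition residue_basis (F : fieldType) (n d : nat) (I : set {mpoly F[n]})
    (e : 'I_d -> {mpoly F[n]}) : Prop :=
  (forall f, exists a : 'I_d -> F, I (f - \sum_(i < d) a i *: e i)) /\
  (forall a : 'I_d -> F, I (\sum_(i < d) a i *: e i) -> forall i, a i = 0).

Definition has_length (F : fieldType) (n d : nat)
    (X : closed_subscheme {mpoly F[n]}) : Prop :=
  exists e : 'I_d -> {mpoly F[n]}, residue_basis (def_ideal X) e.

Definition has_border_basis (F : fieldType) (n mu : nat)
    (t : mu.-tuple 'X_{1..n}) (I : set {mpoly F[n]}) : Prop :=
  residue_basis I (fun i : 'I_mu => 'X_[tnth t i]).

Definition border_coeffs (F : fieldType) (n mu nu : nat)
    (t : mu.-tuple 'X_{1..n}) (b : nu.-tuple 'X_{1..n})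
    (I : set {mpoly F[n]}) (gamma : 'M[F]_(mu, nu)) : Prop :=
  forall j : 'I_nu,
    I ('X_[tnth b j] - \sum_(i < mu) gamma i j *: 'X_[tnth t i]).

(** The polynomial ring [K[c_ij]] is [{mpoly K[mu * nu]}]. *)
Definition c_var (K : fieldType) (mu nu : nat) (i : 'I_mu) (j : 'I_nu) :
  {mpoly K[mu * nu]} := 'X_(mxvec_index i j).

Definition mult_mx (K : fieldType) (n mu nu : nat)
    (t : mu.-tuple 'X_{1..n}) (b : nu.-tuple 'X_{1..n}) (k : 'I_n) :
    'M[{mpoly K[mu * nu]}]_mu :=
  \matrix_(i, m)
    if [pick j | (U_(k) + tnth t m)%MM == tnth b j] is Some j
    then c_var K i j
    else ((U_(k) + tnth t m)%MM == tnth t i)%:R.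

Definition border_basis_scheme (K : fieldType) (n mu nu : nat)
    (t : mu.-tuple 'X_{1..n}) (b : nu.-tuple 'X_{1..n}) :
    closed_subscheme {mpoly K[mu * nu]} :=
  MkClosed (ideal_gen_ideal
    [set f | exists (k l : 'I_n) (i m : 'I_mu),
       f = (mult_mx K t b k *m mult_mx K t b l
            - mult_mx K t b l *m mult_mx K t b k) i m]).

(** The [F]-rational point with coordinates [gamma], as the image of
    [Spec F -> Spec F[c_ij]]. *)
Definition rational_point (F : fieldType) (mu nu : nat)
    (gamma : 'M[F]_(mu, nu)) : Spec {mpoly F[mu * nu]} :=
  spec_map (meval (fun s => mxvec gamma 0 s)) (spec_field_point F).

(** The points [beta(I_X)], where [X] is a closed subscheme of affine
    [n]-space over [L] with vanishing ideal [I_X = def_ideal X]. *)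
Definition reduced_points (L : fieldType) (n mu nu : nat)
    (t : mu.-tuple 'X_{1..n}) (b : nu.-tuple 'X_{1..n}) :
    set (Spec {mpoly L[mu * nu]}) :=
  [set p | exists (X : closed_subscheme {mpoly L[n]}) (gamma : 'M[L]_(mu, nu)),
     [/\ reduced X, has_length mu X, has_border_basis t (def_ideal X),
         border_coeffs t b (def_ideal X) gamma & p = rational_point gamma]].

Arguments reduced_points L {n mu nu} t b.

Definition is_algebraic_closure (K : fieldType) (L : closedFieldType)
    (iota : {rmorphism K -> L}) : Prop :=
  forall z : L, algebraicOver iota z.

Definition is_principal_component (K : fieldType) (L : closedFieldType)
    (iota : {rmorphism K -> L}) (n mu nu : nat)
    (t : mu.-tuple 'X_{1..n}) (b : nu.-tuple 'X_{1..n})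
    (C : closed_subscheme {mpoly K[mu * nu]}) : Prop :=
  subscheme C (border_basis_scheme K t b) /\
  base_change (map_mpoly iota) C = reduced_closure (reduced_points L t b).

Section RingCO.
Context (K : fieldType) (n mu nu : nat).
Context (t : mu.-tuple 'X_{1..n}) (b : nu.-tuple 'X_{1..n}).

(** [y_k^(i)] is ['X_(mxvec_index i k)]. *)
Local Notation Q := {mpoly K[mu * n]}.

(** [m(y^(i))]. *)
Definition term_at (m : 'X_{1..n}) (i : 'I_mu) : Q :=
  \prod_(k < n) 'X_(mxvec_index i k) ^+ m k.

Definition term_mx : 'M[Q]_mu := \matrix_(i, j) term_at (tnth t j) i.

Definition Delta : Q := \det term_mx.

Definition Delta_ij (i : 'I_mu) (j : 'I_nu) : Q :=
  \det (\matrix_(r, s)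
          if s == i then term_at (tnth b j) r else term_mx r s).

Definition Delta_frac (i : 'I_mu) (j : 'I_nu) : {fraction Q} :=
  tofrac (Delta_ij i j) / tofrac Delta.

Definition frac_const (a : K) : {fraction Q} := tofrac a%:MP.

(** The intersection of all [K]-subalgebras containing the generators. *)
Definition in_CO : {pred {fraction Q}} := fun x =>
  `[< forall S : {pred {fraction Q}},
        GRing.subring_closed S ->
        (forall a : K, frac_const a \in S) ->
        (forall i j, Delta_frac i j \in S) -> x \in S >].

Lemma in_CO_subring : GRing.subring_closed in_CO.
Proof.
split=> [|x y|x y].
- by apply/asboolP => S [].
- move=> /asboolP xS /asboolP yS; apply/asboolP => S Sr SK SD.
  by have [_ SB _] := Sr; apply: SB; [apply: xS | apply: yS].
- move=> /asboolP xS /asboolP yS; apply/asboolP => S Sr SK SD.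
  by have [_ _ SM] := Sr; apply: SM; [apply: xS | apply: yS].
Qed.

HB.instance Definition _ := GRing.isSubringClosed.Build _ in_CO in_CO_subring.

Record CO := MkCO { CO_val : {fraction Q}; CO_valP : CO_val \in in_CO }.

HB.instance Definition _ := [isSub for CO_val].
HB.instance Definition _ := [Choice of CO by <:].
HB.instance Definition _ := [SubChoice_isSubComNzRing of CO by <:].

Definition Phi_frac : {mpoly K[mu * nu]} -> {fraction Q} :=
  mmap frac_const (fun s => mxvec (\matrix_(i, j) Delta_frac i j) 0 s).

Lemma Phi_frac_in (f : {mpoly K[mu * nu]}) : Phi_frac f \in in_CO.
Proof.
rewrite /Phi_frac /mmap; apply: rpred_sum => m _; apply: rpredM.
  by apply/asboolP => S _ + _; apply.
rewrite /mmap1; apply: rpred_prod => s _; apply: rpredX.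
case/mxvec_indexP: s => i j; rewrite mxvecE mxE.
by apply/asboolP => S _ _; apply.
Qed.

Definition Phi (f : {mpoly K[mu * nu]}) : CO := MkCO (Phi_frac_in f).

Fact frac_const_additive : zmod_morphism frac_const.
Proof. by move=> x y; rewrite /frac_const mpolyCB rmorphB. Qed.

Fact frac_const_multiplicative : monoid_morphism frac_const.
Proof. by split=> [|x y]; rewrite /frac_const ?mpolyCM ?rmorphM. Qed.

HB.instance Definition _ :=
  GRing.isZmodMorphism.Build K {fraction Q} frac_const frac_const_additive.
HB.instance Definition _ :=
  GRing.isMonoidMorphism.Build K {fraction Q} frac_const
    frac_const_multiplicative.
HB.instance Definition _ := GRing.RMorphism.copy Phi_frac Phi_frac.

Fact Phi_additive : zmod_morphism Phi.
Proof. by move=> f g; apply: val_inj; rewrite /= rmorphB. Qed.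

Fact Phi_multiplicative : monoid_morphism Phi.
Proof.
by split=> [|f g]; apply: val_inj; rewrite /= ?rmorphM ?rmorph1.
Qed.

HB.instance Definition _ :=
  GRing.isZmodMorphism.Build {mpoly K[mu * nu]} CO Phi Phi_additive.
HB.instance Definition _ :=
  GRing.isMonoidMorphism.Build {mpoly K[mu * nu]} CO Phi Phi_multiplicative.

Lemma Phi_const (a : K) : val (Phi a%:MP) = frac_const a.
Proof. by rewrite /= /Phi_frac mmapC. Qed.

Lemma Phi_c_var (i : 'I_mu) (j : 'I_nu) :
  val (Phi (c_var K i j)) = Delta_frac i j.
Proof. by rewrite /= /Phi_frac /c_var mmapX mmap1U mxvecE mxE. Qed.

Lemma Phi_surjective (x : CO) : exists f, Phi f = x.
Proof.
pose S : {pred {fraction Q}} := fun y => `[< exists f, Phi_frac f = y >].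
suff /asboolP[f fx] : CO_val x \in S by exists f; apply: val_inj.
have /asboolP := CO_valP x; apply.
- split=> [|y z|y z].
  + by apply/asboolP; exists 1; rewrite rmorph1.
  + move=> /asboolP[f <-] /asboolP[g <-].
    by apply/asboolP; exists (f - g); rewrite rmorphB.
  + move=> /asboolP[f <-] /asboolP[g <-].
    by apply/asboolP; exists (f * g); rewrite rmorphM.
- by move=> a; apply/asboolP; exists a%:MP; rewrite -Phi_const.
- by move=> i j; apply/asboolP; exists (c_var K i j); rewrite -Phi_c_var.
Qed.

End RingCO.

(* Main.v *)
Require Import Defs.
From mathcomp Require Import all_boot all_algebra all_field.
From mathcomp Require Import boolp classical_sets topology_structure.
From mathcomp Require Import mpoly.
From HB Require Import structures.

(** Write [gamma_ij = Delta_ij / Delta]. By Cramer's rule these are the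
    coefficients expressing the values of the border terms at the [mu] generic
    points [y^(1), ..., y^(mu)] through the values of the terms of the order
    ideal. The identity makes sense after every ring morphism [phi] from [Q] to
    a field with [phi Delta != 0]. The embedding of [Q] into its fraction field
    computes [Phi]; the evaluations at [mu] points of affine space over [L]
    compute the border basis coefficients of the vanishing ideal of these
    points. The two can be compared because finitely many polynomials in the
    [c_ij] have a common denominator [Delta ^+ N] that serves for all [phi]
    simultaneously (common_denominator).

    The set of points [beta(I_X)] is therefore the set of the [gamma(p)] for
    the [mu]-tuples [p] of points with [Delta(p) != 0] (reduced_pointsP).
    That every reduced [X] arises in this way is the zero-dimensional
    Nullstellensatz (reduced_zero_avoiding): since no nontrivial combination of
    the terms of the order ideal lies in [I_X], none vanishes at all the zeros
    of [I_X], so [mu] of these zeros can be chosen at which the term matrix is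
    invertible (points_of_full_rank).

    A polynomial [F] over [L] vanishing at all [gamma(p)] is expanded as
    [\sum_s e_s f_s] with [f_s] over [K] and [e_s] linearly independent over
    [K]. Clearing denominators, [Delta * \sum_s e_s h_s] vanishes at every
    point, hence is zero, and so are all [h_s]; this says [Phi f_s = 0]. Thus
    the vanishing ideal of the points [beta(I_X)] is the extension of the
    kernel of [Phi] to [L] (reduced_points_vanishing). Ideals over [K] with the
    same extension to [L] coincide (ideal_gen_map_contract), which identifies
    the ideal of the principal component with the kernel of [Phi].

    This kernel is prime, since [Phi] takes values in a subring of a field;
    hence the component is irreducible, and it is the closure of the image of
    [Spec C_O], to which its generic point belongs. It lies in the border basis
    scheme because, in the basis given by the term matrix at the generic
    points, the multiplication matrices become diagonal with entries [y_k^(i)]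
    (mulmx_mult_mx_at), so that they commute. *)

Set Implicit Arguments.
Unset Strict Implicit.
Unset Printing Implicit Defensive.

Import GRing.Theory.

Local Open Scope classical_set_scope.
Local Open Scope ring_scope.


(** * Ideals and the Zariski topology *)

Lemma is_ideal_sub (A : comNzRingType) (I : set A) (f g : A) :
  is_ideal I -> I f -> I g -> I (f - g).
Proof.
by move=> [_ ID IM] If Ig; apply: ID => //; rewrite -mulN1r; apply: IM.
Qed.

Lemma is_ideal_sum (A : comNzRingType) (I : set A) (J : finType) (f : J -> A) :
  is_ideal I -> (forall j, I (f j)) -> I (\sum_j f j).
Proof. by move=> [I0 ID _] If; elim/big_ind: _ => // j _; apply: If. Qed.

Lemma ideal_gen_mem (A : comNzRingType) (E : set A) (f : A) :
  E f -> ideal_gen E f.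
Proof.
move=> Ef; exists 1, (fun=> 1), (fun=> f); split=> //.
by rewrite big_ord1 mul1r.
Qed.

Lemma closed_zero_locusP (A : comNzRingType) (Z : set (Spec A)) :
  closed Z <-> exists E, Z = zero_locus E.
Proof.
rewrite -openC; split=> [[E ZE]|[E ->]]; last by exists E.
by exists E; rewrite -[Z]setCK ZE setCK.
Qed.

(** A closed set is the zero locus of its vanishing ideal, and the closed sets
    containing [S] are the zero loci of the sets of functions vanishing on
    [S]. *)
Lemma closureE_zero_locus (A : comNzRingType) (S : set (Spec A)) :
  closure S = zero_locus (vanishing_ideal S).
Proof.
apply/seteqP; split=> [q|q Sq].
  rewrite closureE; apply; split=> [|p Sp f]; last exact.
  by apply/closed_zero_locusP; exists (vanishing_ideal S).
rewrite closureE => _ [/closed_zero_locusP[E ->] SE] f Ef; apply: Sq => p Sp.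
exact: SE Sp _ Ef.
Qed.

Lemma vanishing_ideal_closure (A : comNzRingType) (S : set (Spec A)) :
  vanishing_ideal (closure S) = vanishing_ideal S.
Proof.
rewrite closureE_zero_locus; apply/seteqP; split=> f fS p Sp; last exact: Sp.
by apply: fS => g; apply.
Qed.

(** The prime ideal [I] is itself a point of its zero locus: a closed set
    containing this generic point contains the whole locus. *)
Lemma irreducible_zero_locus (A : comNzRingType) (I : set A) :
  is_prime_ideal I -> irreducible_set (zero_locus I).
Proof.
move=> pI; split; first by exists (MkSpec pI).
move=> F G /closed_zero_locusP[E ->] /closed_zero_locusP[E' ->] sub.
have [//|EI|E'I] := sub (MkSpec pI).
  by left=> p Ip f /EI; apply: Ip.
by right=> p Ip f /E'I; apply: Ip.
Qed.

Lemma vanishing_zero_locus (A : comNzRingType) (I : set A) :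
  is_prime_ideal I -> vanishing_ideal (zero_locus I) = I.
Proof.
move=> pI; apply/seteqP; split=> [f /(_ (MkSpec pI))|f If p]; first exact.
exact.
Qed.

(** * Polynomials and points *)

Lemma meval_map_mpoly (R S : comNzRingType) (f : {rmorphism R -> S}) (n : nat)
    (v : 'I_n -> S) (p : {mpoly R[n]}) :
  (map_mpoly f p).@[v] = mmap f v p.
Proof.
rewrite /map_mpoly /mmap rmorph_sum /=; apply: eq_bigr => m _.
by rewrite rmorphM /= mevalC mmap1_id mevalX.
Qed.

(** Viewing [p] as a polynomial in the last variable only regroups its
    monomials, so that no coefficient is lost. *)
Lemma mcoeff_muni (R : nzRingType) (n : nat) (p : {mpoly R[n.+1]})
    (m : 'X_{1..n.+1}) :
  (muni p)`_(m ord_max)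
    @_[multinom m (widen_ord (leqnSn n) i) | i < n] = p@_m.
Proof.
rewrite muniE coef_sum raddf_sum /= [in RHS](mpolyE p) raddf_sum /=.
apply: eq_bigr => m' _; rewrite mcoeffZ mcoeffX coefZ coefXn.
have [m'm|m'm] := eqVneq (m' ord_max) (m ord_max); last first.
  rewrite mulr0 mcoeff0 (_ : m' == m = false) ?mulr0 //.
  by apply: contraNF m'm => /eqP->.
rewrite mulr1 mcoeffZ mcoeffX; congr (_ * (nat_of_bool _)%:R).
apply/eqP/eqP => [eqm|->//]; apply/mnmP => i.
have [lt_in|] := ltnP i n.
  have := congr1 (fun m : 'X_{1..n} => m (Ordinal lt_in)) eqm.
  by rewrite !mnmE (_ : widen_ord _ _ = i) //; apply: val_inj.
move=> le_ni; suff -> : i = ord_max by [].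
by apply: val_inj; apply/eqP; rewrite eqn_leq le_ni -ltnS ltn_ord.
Qed.

(** Induction on the number of variables: some coefficient of [p], seen as a
    polynomial in the last variable, is nonzero at a suitable [v]; then [p]
    specializes at [v] to a nonzero polynomial in one variable, which has a
    nonroot. *)
Lemma mpoly_nonzero_point (L : closedFieldType) (n : nat) (p : {mpoly L[n]}) :
  p != 0 -> exists v, p.@[v] != 0.
Proof.
elim: n p => [|n IHn] p p0.
  exists (fun=> 0); apply: contra p0.
  rewrite [X in X.@[_]]nvar0_mpolyC mevalC => /eqP p00.
  by rewrite [p]nvar0_mpolyC p00 mpolyC0.
set m := mlead p; set m' := [multinom m (widen_ord (leqnSn n) i) | i < n].
have pm : (muni p)`_(m ord_max) != 0.
  apply: contraTneq (mlead_supp p0) => pm0.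
  by rewrite mcoeff_msupp -mcoeff_muni pm0 mcoeff0 eqxx.
have [v pmv] := IHn _ pm.
have : map_poly (meval v) (muni p) != 0.
  apply: contraNneq pmv => /polyP/(_ (m ord_max)).
  by rewrite coef_map coef0 => ->.
case/closed_nonrootP => x; rewrite /root => px.
pose w (i : 'I_n.+1) := if unlift ord_max i is Some j then v j else x.
exists w; suff <- : (map_poly (meval v) (muni p)).[x] = p.@[w] by [].
rewrite muniE mevalE !raddf_sum horner_sum /=; apply: eq_bigr => m'' _.
rewrite map_polyZ map_polyXn hornerZ hornerXn /= mevalZ mevalX -mulrA.
rewrite big_ord_recr /= /w unlift_none; congr (_ * (_ * _)).
apply: eq_bigr => i _; rewrite mnmE.
have -> : widen_ord (leqnSn n) i = lift ord_max i.
  by apply: val_inj; rewrite [RHS]lift_max.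
by rewrite liftK.
Qed.

(** The points are chosen one at a time. As long as there are fewer than [d],
    some nonzero combination of the [e j] vanishes at all of them; a point of
    [Z] where it does not vanish yields a row outside the span of the previous
    ones. *)
Lemma points_of_full_rank (F : fieldType) (T : Type) (d : nat)
    (Z : T -> Prop) (e : 'I_d -> T -> F) :
  (forall a : 'I_d -> F,
     (forall x, Z x -> \sum_(j < d) a j * e j x = 0) -> forall j, a j = 0) ->
  exists x : 'I_d -> T,
    (forall i, Z (x i)) /\ \det (\matrix_(i, j) e j (x i)) != 0.
Proof.
move=> indep.
suff choose k : (k <= d)%N -> exists x : 'I_k -> T,
    (forall i, Z (x i)) /\ row_free (\matrix_(i < k, j < d) e j (x i)).
  have [x [Zx free]] := choose d (leqnn d); exists x; split=> //.
  by rewrite -unitfE -[_ \is a _]/(_ \in unitmx) -row_free_unit.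
elim: k => [_|k IHk ltkd].
  have f0 : 'I_0 -> T by case.
  by exists f0; split=> [[]//|]; rewrite /row_free -leqn0 rank_leq_row.
have [x [Zx free]] := IHk (ltnW ltkd).
set M := \matrix_(i, j) _ in free.
have [a Ma a0] : exists2 a : 'cV_d, M *m a = 0 & a != 0.
  have : kermx M^T != 0.
    rewrite kermx_eq0 /row_free mxrank_tr (eqP free) neq_ltn ltkd //.
  case/rowV0Pn=> u /sub_kermxP uM u0; exists u^T; last by rewrite trmx_eq0.
  by rewrite -[M]trmxK -trmx_mul uM trmx0.
have [y Zy ya] : exists2 y, Z y & \sum_(j < d) a j 0 * e j y != 0.
  apply: contrapT => none; case/eqP: a0; apply/matrixP => j j0.
  rewrite mxE ord1; apply: (indep (a^~ 0)) => y Zy; apply: contrapT => /eqP ya.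
  by apply: none; exists y.
pose x' (i : 'I_(1 + k)) := if split i is inr i' then x i' else y.
exists x'; split=> [i|]; first by rewrite /x'; case: split.
have -> : \matrix_(i, j) e j (x' i) = col_mx (\row_j e j y) M.
  apply/matrixP => i j; rewrite mxE [RHS]mxE /x'.
  by case: split => i'; rewrite mxE.
have notin : ~~ (\row_j e j y <= M)%MS.
  apply: contra ya => /submxP[u yM].
  have /matrixP/(_ 0 0) : (\row_j e j y) *m a = 0.
    by rewrite yM -mulmxA Ma mulmx0.
  rewrite !mxE => yaE; apply/eqP; rewrite -[RHS]yaE.
  by apply: eq_bigr => j _; rewrite mxE mulrC.
have sub : (\row_j e j y + M <= col_mx (\row_j e j y) M)%MS by rewrite addsmxE.
rewrite /row_free eqn_leq rank_leq_row /= -[X in (X < _)%N](eqP free).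
apply: rank_ltmx; rewrite ltmxE (submx_trans (addsmxSr _ _) sub) /=.
by apply: contra notin; apply: submx_trans (submx_trans (addsmxSl _ _) sub).
Qed.

(** * Zeros of reduced ideals of finite codimension *)

Section Nullstellensatz.
Context (F : closedFieldType) (n : nat) (I : set {mpoly F[n]}).
Hypothesis iI : is_ideal I.

(** The factors [g - z] multiply [v] into [I] one after the other; the last
    multiple of [v] outside [I] is an eigenvector of [g] modulo [I]. *)
Lemma eigenvector_of_factors (g v : {mpoly F[n]}) (zs : seq F) :
  ~ I v -> I ((\prod_(z <- zs) (g - z%:MP)) * v) ->
  exists z h, ~ I (h * v) /\ I ((g - z%:MP) * (h * v)).
Proof.
elim: zs v => [|z zs IHzs] v nIv; first by rewrite big_nil mul1r.
rewrite big_cons => Igv.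
have [Iw|nIw] := pselect (I ((g - z%:MP) * v)).
  by exists z, 1; rewrite mul1r.
have [|z' [h [nI II]]] := IHzs _ nIw; first by rewrite mulrCA mulrA.
by exists z', (h * (g - z%:MP)); rewrite -mulrA.
Qed.

Context (d : nat) (e : 'I_d -> {mpoly F[n]}).
Hypothesis eI : residue_basis I e.

(** The powers [1, g, ..., g^d] are [d + 1] vectors in a space of dimension
    [d]. *)
Lemma algebraic_mod_ideal (g : {mpoly F[n]}) :
  exists2 P : {poly F}, P != 0 & I (map_poly (@mpolyC n F) P).[g].
Proof.
have [_ ID IM] := iI.
have /choice[M MP] := fun i : 'I_d.+1 => eI.1 (g ^+ i).
pose A := \matrix_(i, j) M i j.
have : kermx A != 0.
  by rewrite kermx_eq0 /row_free neq_ltn ltnS rank_leq_col.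
case/rowV0Pn=> u /sub_kermxP uA u0; exists (rVpoly u).
  by apply: contra u0 => /eqP Pu; rewrite -[u]rVpolyK Pu linear0.
have -> : (map_poly (@mpolyC n F) (rVpoly u)).[g] =
    \sum_(i < d.+1) (u 0 i)%:MP * (g ^+ i - \sum_(j < d) M i j *: e j).
  under [RHS]eq_bigr do rewrite mulrBr.
  rewrite sumrB [X in _ - X](_ : _ = 0) ?subr0; last first.
    under eq_bigr => i _ do rewrite mulr_sumr.
    rewrite exchange_big big1 //= => j _.
    have /matrixP/(_ 0 j) := uA; rewrite !mxE => uAj.
    under eq_bigr => i _ do rewrite mul_mpolyC scalerA.
    rewrite -scaler_suml (_ : \sum_i _ = 0) ?scale0r // -[RHS]uAj.
    by apply: eq_bigr => i _; rewrite mxE.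
  rewrite (horner_coef_wide _ (n := d.+1)); last first.
    by rewrite (leq_trans (size_poly _ _)) // (leq_trans (size_poly _ _)).
  by apply: eq_bigr => i _; rewrite coef_map /= coef_rVpoly_ord.
by apply: is_ideal_sum => // i; apply: IM.
Qed.

Lemma eigenvector_mod_ideal (g v : {mpoly F[n]}) :
  ~ I v -> exists z h, ~ I (h * v) /\ I ((g - z%:MP) * (h * v)).
Proof.
move=> nIv; have [_ _ IM] := iI.
have [P P0 IP] := algebraic_mod_ideal g.
have [zs Pzs] := closed_field_poly_normal P.
apply: (eigenvector_of_factors (zs := zs)) => //; rewrite mulrC; apply: (IM).
have : I ((lead_coef P)^-1%:MP * (map_poly (@mpolyC n F) P).[g]) by apply: IM.
rewrite [X in map_poly _ X]Pzs map_polyZ hornerZ mulrA -mpolyCM.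
rewrite mulVf ?lead_coef_eq0 //.
rewrite mpolyC1 mul1r rmorph_prod horner_prod /=.
rewrite (eq_bigr (fun z => g - z%:MP)) // => z _.
by rewrite rmorphB /= map_polyX map_polyC /= !hornerE.
Qed.

Lemma common_eigenvector_mod_ideal (gs : seq {mpoly F[n]}) (v : {mpoly F[n]}) :
  ~ I v -> exists h, ~ I (h * v) /\
    forall g, g \in gs -> exists z : F, I ((g - z%:MP) * (h * v)).
Proof.
have [_ _ IM] := iI.
move=> nIv; elim: gs => [|g gs [h [nIhv hP]]].
  by exists 1; rewrite mul1r.
have [z [h' [nI II]]] := eigenvector_mod_ideal g nIhv.
exists (h' * h); rewrite -mulrA; split=> // g'.
rewrite inE => /predU1P[->|/hP[z' Iz']]; first by exists z.
by exists z'; rewrite mulrCA; apply: IM.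
Qed.

(** The zero is read off from the eigenvalues of the variables on a common
    eigenvector [w], outside [I], chosen among the multiples of an eigenvector
    [h * f] of [f]. Each polynomial [g] then acts on [w] as its value at [x];
    hence elements of [I] vanish at [x], and [f] takes there its own
    eigenvalue, which is nonzero because otherwise the square of [h * f] would
    lie in [I]. *)
Lemma reduced_zero_avoiding (f : {mpoly F[n]}) :
  (forall g k, I (g ^+ k) -> I g) -> ~ I f ->
  exists x, (forall g, I g -> g.@[x] = 0) /\ f.@[x] != 0.
Proof.
move=> red nIf; have [I0 ID IM] := iI.
have [z [h [nIhf Iz]]] := eigenvector_mod_ideal f nIf.
(* If [z] were zero, [f * (h * f)] and thus [(h * f) ^+ 2] would lie in [I]. *)
have z0 : z != 0.
  apply: contra_notN nIhf => /eqP z0; apply: (red _ 2).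
  by rewrite z0 mpolyC0 subr0 in Iz; rewrite expr2 -mulrA; apply: IM.
have [h' [nIw]] := common_eigenvector_mod_ideal [seq 'X_i | i : 'I_n] nIhf.
move: {nIhf} (IM h' _ Iz); rewrite mulrCA.
set w := h' * _ in nIw * => Ifw eigw.
have /choice[x xP] : forall i : 'I_n, exists z : F, I (('X_i - z%:MP) * w).
  by move=> i; apply: eigw; apply: map_f; rewrite mem_enum.
pose E g := I ((g - (g.@[x])%:MP) * w).
have EM g g' : E g -> E g' -> E (g * g').
  rewrite /E => Eg Eg'; rewrite mevalM.
  have -> : (g * g' - (g.@[x] * g'.@[x])%:MP) * w =
      g * ((g' - (g'.@[x])%:MP) * w) + (g'.@[x])%:MP * ((g - (g.@[x])%:MP) * w).
    rewrite mpolyCM !mulrBl !mulrBr addrA !mulrA.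
    by rewrite (mulrC (g'.@[x])%:MP g) subrK (mulrC (g'.@[x])%:MP).
  by apply: ID; apply: IM.
have ED g g' : E g -> E g' -> E (g + g').
  rewrite /E => Eg Eg'; rewrite mevalD mpolyCD opprD addrACA mulrDl.
  exact: ID.
have EC c : E c%:MP by rewrite /E mevalC subrr mul0r.
have EX i : E 'X_i by rewrite /E mevalXU.
have Eall g : E g.
  elim/mpolyind: g => [|c m p _ _ Ep]; first by rewrite -mpolyC0; apply: EC.
  apply: ED => //; rewrite -mul_mpolyC; apply: (EM); first exact: EC.
  rewrite mpolyXE_id; elim/big_rec: _ => [|i g _ Eg]; first exact: EC.
  apply: (EM) => //; elim: (m i) => [|k IHk]; first by rewrite expr0; exact: EC.
  by rewrite exprS; apply: EM.
have const0 c : I (c%:MP * w) -> c = 0.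
  move=> Icw; apply: contrapT => /eqP c0; apply: nIw.
  by have := IM (c^-1%:MP) _ Icw; rewrite mulrA -mpolyCM mulVf // mpolyC1 mul1r.
exists x; split=> [g Ig|].
  apply: const0; have := is_ideal_sub iI (IM w _ Ig) (Eall g).
  by rewrite mulrC -mulrBl opprB addrCA subrr addr0.
suff -> : f.@[x] = z by [].
apply/eqP; rewrite -subr_eq0; apply/eqP/const0.
have := is_ideal_sub iI Ifw (Eall f).
by rewrite -mulrBl opprB addrCA addrAC subrr add0r -mpolyCB.
Qed.

End Nullstellensatz.

(** * Extension of scalars *)

Section ScalarExtension.
Context (K L : fieldType) (iota : {rmorphism K -> L}).

Definition independent (r : nat) (e : 'I_r -> L) : Prop :=
  forall a : 'I_r -> K, \sum_s e s * iota (a s) = 0 -> forall s, a s = 0.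

Definition in_span (r : nat) (e : 'I_r -> L) (z : L) : Prop :=
  exists a : 'I_r -> K, z = \sum_s e s * iota (a s).

Lemma finite_independent_span (zs : seq L) :
  exists (r : nat) (e : 'I_r -> L),
    independent e /\ forall z, z \in zs -> in_span e z.
Proof.
elim: zs => [|z zs [r [e [ie ze]]]].
  by exists 0, (fun=> 0); split=> [a _ []//|].
have [zin|nzin] := pselect (in_span e z).
  by exists r, e; split=> // z'; rewrite inE => /predU1P[->//|/ze].
pose e' (i : 'I_r.+1) := if unlift ord0 i is Some j then e j else z.
have e'E (a : 'I_r.+1 -> K) : \sum_s e' s * iota (a s) =
    z * iota (a ord0) + \sum_s e s * iota (a (lift ord0 s)).
  rewrite big_ord_recl /e' unlift_none; congr (_ + _).
  by apply: eq_bigr => s _; rewrite liftK.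
exists r.+1, e'; split=> [a|z'].
  rewrite e'E => a0; have a00 : a ord0 = 0.
    apply: contrapT => /eqP a00; apply: nzin.
    exists (fun s => - (a (lift ord0 s) / a ord0)).
    apply: (mulIf (x := iota (a ord0))); first by rewrite fmorph_eq0.
    move/eqP: a0; rewrite addr_eq0 => /eqP->; rewrite mulr_suml -sumrN.
    apply: eq_bigr => s _; rewrite -mulrA -rmorphM mulNr -mulrA mulVf //.
    by rewrite mulr1 rmorphN mulrN.
  move: a0; rewrite a00 rmorph0 mulr0 add0r => /ie a1 s.
  by case: (unliftP ord0 s) => [j ->|->].
rewrite inE => /predU1P[->|/ze[a ->]].
  exists (fun s => (s == ord0)%:R); rewrite e'E eqxx rmorph1 mulr1.
  rewrite big1 ?addr0 // => s _.
  by rewrite rmorph0 mulr0.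
exists (fun s => if unlift ord0 s is Some j then a j else 0).
rewrite e'E unlift_none rmorph0 mulr0 add0r; apply: eq_bigr => s _.
by rewrite liftK.
Qed.

Context (k : nat).

Lemma independent_mpoly (r : nat) (e : 'I_r -> L) (h : 'I_r -> {mpoly K[k]}) :
  independent e -> \sum_s e s *: map_mpoly iota (h s) = 0 -> forall s, h s = 0.
Proof.
move=> ie h0 s; apply/mpolyP => m; rewrite mcoeff0.
apply: (ie (fun s => (h s)@_m)).
have := congr1 (mcoeff m) h0; rewrite raddf_sum mcoeff0 => h0m.
rewrite -[RHS]h0m; apply: eq_bigr => i _.
by rewrite /= mcoeffZ mcoeff_map_mpoly.
Qed.

(** Having [1] in the span of the same family makes it possible to compare
    the expansion of an arbitrary polynomial with that of a polynomial defined
    over [K]. *)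
Lemma independent_expansion (Fs : seq {mpoly L[k]}) :
  exists (r : nat) (e : 'I_r -> L),
    [/\ independent e, in_span e 1 &
      forall F, F \in Fs -> exists f : 'I_r -> {mpoly K[k]},
        F = \sum_s e s *: map_mpoly iota (f s)].
Proof.
have [r [e [ie ze]]] := finite_independent_span
  (1 :: flatten [seq [seq F@_m | m <- msupp F] | F : {mpoly L[k]} <- Fs]).
exists r, e; split=> // [|F FFs]; first by apply: ze; rewrite mem_head.
have /choice[a aP] : forall m, exists a : 'I_r -> K,
    m \in msupp F -> F@_m = \sum_s e s * iota (a s).
  move=> m; have [mF|_] := boolP (m \in msupp F); last by exists (fun=> 0).
  have [|a aE] := ze F@_m; last by exists a.
  rewrite inE; apply/orP; right; apply/flatten_mapP; exists F => //.
  exact: map_f.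
exists (fun s => \sum_(m <- msupp F) a m s *: 'X_[m]).
under eq_bigr => s _ do rewrite rmorph_sum scaler_sumr /=.
rewrite exchange_big /= [LHS]mpolyE big_seq [RHS]big_seq.
apply: eq_bigr => m mF.
rewrite (aP m mF) scaler_suml; apply: eq_bigr => s _.
by rewrite map_mpolyZ map_mpolyX scalerA.
Qed.

(** The morphism from [K[x]] to [L[x]] is faithfully flat. Concretely, with
    [1 = \sum_u e_u c_u], the coefficients of [e_u] in a relation
    [f = \sum_s a_s g_s] over [L] give relations over [K] exhibiting each
    [c_u f] as an element of [I], and some [c_u] is nonzero. *)
Lemma ideal_gen_map_contract (I : set {mpoly K[k]}) (f : {mpoly K[k]}) :
  is_ideal I -> ideal_gen (map_mpoly iota @` I) (map_mpoly iota f) -> I f.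
Proof.
move=> iI [r [a [g [gI fE]]]]; have [I0 ID IM] := iI.
have /choice[g' g'P] : forall s, exists g', I g' /\ map_mpoly iota g' = g s.
  by move=> s; have [g' Ig' <-] := gI s; exists g'.
have [d [e [ie [c c1] aP]]] := independent_expansion (codom a).
have /choice[f' f'P] := fun s => aP (a s) (codom_f a s).
have cf u : c u *: f = \sum_s f' s u * g' s.
  apply/eqP; rewrite -subr_eq0; apply/eqP; move: u.
  apply: (independent_mpoly ie).
  under eq_bigr do rewrite rmorphB scalerBr.
  rewrite sumrB; apply/eqP; rewrite subr_eq0; apply/eqP.
  transitivity (map_mpoly iota f).
    rewrite -[RHS]scale1r c1 scaler_suml; apply: eq_bigr => u _.
    by rewrite /= map_mpolyZ scalerA.
  rewrite fE; under [RHS]eq_bigr do rewrite rmorph_sum scaler_sumr.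
  rewrite exchange_big; apply: eq_bigr => s _ /=.
  rewrite f'P mulr_suml -(g'P s).2; apply: eq_bigr => u _.
  by rewrite rmorphM scalerAl.
have [u cu] : exists u, c u != 0.
  apply: contrapT => nc; have /eqP := oner_neq0 L; apply; rewrite c1.
  apply: big1 => u _; suff -> : c u = 0 by rewrite rmorph0 mulr0.
  by apply: contrapT => /eqP cu; apply: nc; exists u.
have -> : f = (c u)^-1%:MP * \sum_s f' s u * g' s.
  by rewrite -cf mul_mpolyC scalerA mulVf // scale1r.
by apply: (IM); apply: is_ideal_sum => // s; apply: (IM); have [] := g'P s.
Qed.

End ScalarExtension.

(** * Specializations of the generic border basis *)

Lemma mulmx_cramer (R : comNzRingType) (m k : nat) (A : 'M[R]_m)
    (B : 'M[R]_(m, k)) :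
  A *m \matrix_(i, j) \det (\matrix_(r, s) if s == i then B r j else A r s)
  = \det A *: B.
Proof.
rewrite -mul_scalar_mx -mul_mx_adj -mulmxA; congr (_ *m _).
apply/matrixP => i j; rewrite !mxE (expand_det_col _ i); apply: eq_bigr => r _.
rewrite !mxE eqxx mulrC; congr (_ * _); rewrite /cofactor. congr (_ * \det _).
by apply/matrixP => r' s; rewrite !mxE eq_sym (negbTE (neq_lift _ _)).
Qed.

Section Specialization.
Context (K : fieldType) (n mu nu : nat).
Context (t : mu.-tuple 'X_{1..n}) (b : nu.-tuple 'X_{1..n}).
Local Notation Q := {mpoly K[mu * n]}.
Local Notation Delta := (Delta K t).

(** The coefficients of the generic border basis, specialized along [phi]. *)
Definition coeffs_at (F : fieldType) (phi : {rmorphism Q -> F}) :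
    'M[F]_(mu, nu) :=
  \matrix_(i, j) (phi (Delta_ij K t b i j) / phi Delta).

Definition eval_at (F : fieldType) (phi : {rmorphism Q -> F}) :
    {mpoly K[mu * nu]} -> F :=
  mmap (phi \o @mpolyC _ K) (fun s => mxvec (coeffs_at phi) 0 s).

HB.instance Definition _ F phi :=
  GRing.RMorphism.copy (@eval_at F phi) (@eval_at F phi).

(** Cramer's rule: [coeffs_at phi] solves the interpolation problem of writing
    the border terms as combinations of the terms of the order ideal at the
    specialized points. *)
Lemma mulmx_coeffs_at (F : fieldType) (phi : {rmorphism Q -> F}) :
  phi Delta != 0 ->
  map_mx phi (term_mx K t) *m coeffs_at phi
  = \matrix_(r, j) phi (term_at K (tnth b j) r).
Proof.
move=> phiD; set B := \matrix_(r, j) _.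
have -> : coeffs_at phi = (phi Delta)^-1 *: \matrix_(i, j)
    \det (\matrix_(r, s)
      if s == i then B r j else map_mx phi (term_mx K t) r s).
  apply/matrixP => i j; rewrite !mxE mulrC /Delta_ij -!det_map_mx.
  congr (_ * \det _).
  by apply/matrixP => r s; rewrite !mxE; case: ifP.
by rewrite -scalemxAr mulmx_cramer det_map_mx scalerA mulVf // scale1r.
Qed.

(** The numerators [h] do not depend on [phi]. This is what transports the
    vanishing of [Phi f] to the vanishing of [f] at the points with
    [Delta != 0], and back. *)
Lemma common_denominator (r : nat) (f : 'I_r -> {mpoly K[mu * nu]}) :
  exists (N : nat) (h : 'I_r -> Q),
    forall s (F : fieldType) (phi : {rmorphism Q -> F}),
    phi Delta != 0 -> eval_at phi (f s) = phi (h s) / phi Delta ^+ N.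
Proof.
pose P (f : {mpoly K[mu * nu]}) (N : nat) := exists h,
  forall (F : fieldType) (phi : {rmorphism Q -> F}), phi Delta != 0 ->
    eval_at phi f = phi h / phi Delta ^+ N.
have Praise g N N' : P g N -> (N <= N')%N -> P g N'.
  move=> [h hP] leN; exists (h * Delta ^+ (N' - N)) => F phi phiD.
  rewrite (hP _ _ phiD) rmorphM rmorphXn.
  have -> : phi Delta ^+ N' = phi Delta ^+ (N' - N) * phi Delta ^+ N.
    by rewrite -exprD subnK.
  by rewrite invfM mulrA mulfK // expf_neq0.
have PM g g' N N' : P g N -> P g' N' -> P (g * g') (N + N')%N.
  move=> [h hP] [h' hP']; exists (h * h') => F phi phiD.
  rewrite [LHS]rmorphM /= (hP _ _ phiD) (hP' _ _ phiD).
  by rewrite rmorphM exprD invfM mulrACA.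
have PD g g' N : P g N -> P g' N -> P (g + g') N.
  move=> [h hP] [h' hP']; exists (h + h') => F phi phiD.
  by rewrite [LHS]rmorphD /= (hP _ _ phiD) (hP' _ _ phiD) rmorphD mulrDl.
have PC c : P c%:MP 0.
  by exists c%:MP => F phi _; rewrite /eval_at mmapC divr1.
have PX s : P 'X_s 1.
  case/mxvec_indexP: s => i j; exists (Delta_ij K t b i j) => F phi _.
  by rewrite /eval_at mmapX mmap1U mxvecE mxE.
have PXn m : exists N, P 'X_[m] N.
  rewrite mpolyXE_id; elim/big_rec: _ => [|s g _ [N PN]].
    by exists 0; rewrite -mpolyC1.
  elim: (m s) => [|k [N' IHk]]; first by exists N; rewrite expr0 mul1r.
  by exists (1 + N')%N; rewrite exprS -mulrA; apply: PM.
have Pf g : exists N, P g N.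
  elim/mpolyind: g => [|c m p _ _ [N PN]]; first by exists 0; rewrite -mpolyC0.
  have [N' PN'] := PXn m; exists (N' + N)%N; apply: PD.
    rewrite -mul_mpolyC; apply: (PM _ _ 0 (N' + N)%N) => //.
    exact: Praise PN' (leq_addr _ _).
  exact: Praise PN (leq_addl _ _).
have /choice[N PN] := fun s => Pf (f s).
have /choice[h hP] := fun s =>
  Praise _ _ (\max_s N s)%N (PN s) (leq_bigmax s).
by exists (\max_s N s)%N, h => s F phi phiD; apply: hP.
Qed.

Lemma term_atD (m m' : 'X_{1..n}) (r : 'I_mu) :
  term_at K (m + m')%MM r = term_at K m r * term_at K m' r.
Proof. by apply: commr_mmap1_M => i x; apply: mulrC. Qed.

Lemma term_atU (k : 'I_n) (r : 'I_mu) :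
  term_at K U_(k)%MM r = 'X_(mxvec_index r k).
Proof. exact: mmap1U. Qed.

(** On the functions on the specialized points, multiplication by [x_k] is
    diagonal in the basis of the points; the term matrix changes this basis
    into that of the order ideal. *)
Lemma mulmx_mult_mx_at (F : fieldType) (phi : {rmorphism Q -> F}) (k : 'I_n) :
  uniq t -> is_border t b -> phi Delta != 0 ->
  map_mx phi (term_mx K t) *m map_mx (eval_at phi) (mult_mx K t b k)
  = diag_mx (\row_r phi 'X_(mxvec_index r k)) *m map_mx phi (term_mx K t).
Proof.
move=> ut [_ bP] phiD; apply/matrixP => r m; rewrite mul_diag_mx !mxE.
rewrite -rmorphM -term_atU -term_atD.
under eq_bigr do rewrite !mxE.
case: pickP => [j /eqP bj|nb].
  have /matrixP/(_ r j) := mulmx_coeffs_at phiD; rewrite !mxE bj => <-.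
  apply: eq_bigr => i _; rewrite !mxE; congr (_ * _).
  by rewrite /eval_at mmapX mmap1U mxvecE mxE.
have /tnthP[i0 ti0] : (U_(k) + tnth t m)%MM \in t.
  apply: contraT => nt.
  have /tnthP[j bj] : (U_(k) + tnth t m)%MM \in b.
    by apply/bP; split=> //; exists k, (tnth t m); rewrite mem_tnth.
  by have := nb j; rewrite bj eqxx.
rewrite (bigD1 i0) //= ti0 eqxx rmorph1 mulr1 big1 ?addr0 // => i i_i0.
rewrite (_ : tnth t i0 == tnth t i = false) ?rmorph0 ?mulr0 //.
by apply: contraNF i_i0 => /eqP/(tuple_uniqP _ ut) ->.
Qed.

(** The specialized multiplication matrices are simultaneously
    diagonalizable, hence commute. *)
Lemma eval_at_border_basis_scheme (F : fieldType) (phi : {rmorphism Q -> F})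
    (f : {mpoly K[mu * nu]}) :
  uniq t -> is_border t b -> phi Delta != 0 ->
  def_ideal (border_basis_scheme K t b) f -> eval_at phi f = 0.
Proof.
move=> ut bP phiD [r [a [g [gE ->]]]].
have uT : map_mx phi (term_mx K t) \in unitmx.
  by rewrite unitmxE det_map_mx unitfE.
rewrite [LHS]rmorph_sum big1 //= => s _; rewrite [LHS]rmorphM /=.
have [k [l [i [m ->]]]] := gE s.
pose T := map_mx phi (term_mx K t).
pose A j := map_mx (eval_at phi) (mult_mx K t b j).
pose D (j : 'I_n) := diag_mx (\row_r phi 'X_(mxvec_index r j)).
have TA j : T *m A j = D j *m T by apply: mulmx_mult_mx_at.
have TAA j j' : T *m (A j *m A j') = (D j *m D j') *m T.
  by rewrite mulmxA TA -!mulmxA TA.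
set M := _ - _; have -> : eval_at phi (M i m) = map_mx (eval_at phi) M i m.
  by rewrite [RHS]mxE.
rewrite (_ : map_mx _ M = 0) 1?mxE ?mulr0 //.
rewrite map_mxB !map_mxM; apply: (can_inj (mulKmx uT)).
by rewrite mulmx0 mulmxBr !TAA diag_mxC subrr.
Qed.
End Specialization.

(** * Border bases of finite sets of points *)

Section Points.
Context (K : fieldType) (L : closedFieldType) (iota : {rmorphism K -> L}).
Context (n mu nu : nat).
Context (t : mu.-tuple 'X_{1..n}) (b : nu.-tuple 'X_{1..n}).
Local Notation Q := {mpoly K[mu * n]}.
Local Notation Delta := (Delta K t).

Definition eval_points (p : 'M[L]_(mu, n)) : Q -> L :=
  mmap iota (fun s => mxvec p 0 s).

HB.instance Definition _ p :=
  GRing.RMorphism.copy (eval_points p) (eval_points p).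

Lemma eval_pointsE p f :
  eval_points p f = (map_mpoly iota f).@[fun s => mxvec p 0 s].
Proof. by rewrite meval_map_mpoly. Qed.

Lemma eval_points_term p (m : 'X_{1..n}) i :
  eval_points p (term_at K m i) = 'X_[m].@[p i].
Proof.
rewrite [LHS]rmorph_prod /= mevalX; apply: eq_bigr => k _.
by rewrite [LHS]rmorphXn /= /eval_points mmapX mmap1U mxvecE.
Qed.

Definition term_values (p : 'M[L]_(mu, n)) : 'M[L]_mu :=
  \matrix_(i, j) 'X_[tnth t j].@[p i].

Lemma map_term_mx p : map_mx (eval_points p) (term_mx K t) = term_values p.
Proof. by apply/matrixP => i j; rewrite !mxE eval_points_term. Qed.

Lemma eval_points_Delta p : eval_points p Delta = \det (term_values p).
Proof. by rewrite -map_term_mx det_map_mx. Qed.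

Lemma eval_at_points p (f : {mpoly K[mu * nu]}) :
  eval_at t b (eval_points p) f =
  (map_mpoly iota f).@[fun s => mxvec (coeffs_at t b (eval_points p)) 0 s].
Proof.
rewrite meval_map_mpoly /eval_at /mmap; apply: eq_bigr => m _.
by rewrite /= /eval_points mmapC.
Qed.

(** Distinct monomials are linearly independent functions on affine space over
    an infinite field. *)
Lemma exists_generic_points : uniq t -> exists p, eval_points p Delta != 0.
Proof.
move=> ut.
have [|x [_ xP]] := @points_of_full_rank L ('I_n -> L) mu (fun=> True)
  (fun j v => 'X_[tnth t j].@[v]).
  move=> a a0 j.
  have sum0 : \sum_(j < mu) a j *: 'X_[tnth t j] = 0 :> {mpoly L[n]}.
    apply: contrapT => /eqP/mpoly_nonzero_point[v /eqP]; apply.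
    rewrite rmorph_sum /= -[RHS](a0 v I); apply: eq_bigr => i _.
    by rewrite mevalZ.
  have := congr1 (mcoeff (tnth t j)) sum0.
  rewrite raddf_sum /= mcoeff0 (bigD1 j) //= mcoeffZ mcoeffX eqxx mulr1.
  rewrite big1 ?addr0 // => i ij; rewrite mcoeffZ mcoeffX.
  rewrite (_ : _ == _ = false) ?mulr0 //.
  by apply: contraNF ij => /eqP/(tuple_uniqP _ ut) ->.
exists (\matrix_(i, k) x i k); rewrite eval_points_Delta; move: xP.
congr (\det _ != 0); apply/matrixP => i j; rewrite !mxE.
by apply: meval_eq => k; rewrite mxE.
Qed.

(** It suffices to exhibit points over [L] where [Delta] does not vanish. *)
Lemma Delta_neq0 : uniq t -> Delta != 0.
Proof.
by move=> /exists_generic_points[p]; apply: contraNneq => ->; rewrite rmorph0.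
Qed.

Definition ideal_of_points (p : 'M[L]_(mu, n)) : set {mpoly L[n]} :=
  [set h | forall i, h.@[p i] = 0].

Lemma ideal_of_points_ideal p : is_ideal (ideal_of_points p).
Proof.
split=> [i|f g pf pg i|a f pf i]; rewrite ?raddf0 //.
  by rewrite mevalD pf pg addr0.
by rewrite mevalM pf mulr0.
Qed.

(** Reduction modulo the ideal of the points is interpolation at the points,
    which the invertible matrix of term values makes uniquely solvable. *)
Lemma ideal_of_points_basis p :
  \det (term_values p) != 0 -> has_border_basis t (ideal_of_points p).
Proof.
rewrite -unitfE -[_ \is a _]/(_ \in unitmx) => uT.
have evalE (a : 'I_mu -> L) i :
    (\sum_(j < mu) a j *: 'X_[tnth t j]).@[p i]
    = (term_values p *m \col_j a j) i 0.
  rewrite rmorph_sum mxE; apply: eq_bigr => j _.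
  by rewrite /= mevalZ !mxE mulrC.
split=> [f|a a0].
  exists (fun j => (invmx (term_values p) *m \col_i f.@[p i]) j 0) => i.
  rewrite mevalB evalE.
  rewrite (_ : \col_j _ = invmx (term_values p) *m \col_i f.@[p i]).
    by rewrite mulKVmx // mxE subrr.
  by apply/matrixP => j j0; rewrite mxE ord1.
have Ta : term_values p *m \col_j a j = 0.
  by apply/matrixP => i i0; rewrite ord1 -evalE a0 mxE.
move=> j; have /matrixP/(_ j 0) := congr1 (mulmx (invmx (term_values p))) Ta.
by rewrite mulKmx // mulmx0 !mxE.
Qed.

(** From left to right, the points are zeros of the ideal of [X] chosen so
    that the term matrix is invertible; evaluating the border basis there shows
    that its coefficients solve the system solved by [coeffs_at]. *)
Lemma reduced_pointsP (q : Spec {mpoly L[mu * nu]}) :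
  reduced_points L t b q <->
  exists2 p, eval_points p Delta != 0 &
    q = rational_point (coeffs_at t b (eval_points p)).
Proof.
split=> [[X [gamma [red _ basis bc ->]]]|[p pD ->]].
  pose I := def_ideal X.
  have [a a0|x [Zx xP]] := @points_of_full_rank L ('I_n -> L) mu
      (fun v => forall g, I g -> g.@[v] = 0) (fun j v => 'X_[tnth t j].@[v]).
    apply: basis.2; apply: contrapT => nI.
    have [v [Zv /eqP]] := reduced_zero_avoiding (def_idealP X) basis red nI.
    apply; rewrite rmorph_sum /= -[RHS](a0 v Zv).
    by apply: eq_bigr => j _; rewrite mevalZ.
  pose p := \matrix_(i, k) x i k.
  have pE g i : g.@[p i] = g.@[x i] by apply: meval_eq => k; rewrite mxE.
  have TE : term_values p = \matrix_(i, j) 'X_[tnth t j].@[x i].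
    by apply/matrixP => i j; rewrite !mxE pE.
  have pD : eval_points p Delta != 0 by rewrite eval_points_Delta TE.
  exists p => //; congr rational_point.
  have uT : term_values p \in unitmx by rewrite unitmxE unitfE TE.
  apply: (can_inj (mulKmx uT)); rewrite -{2}map_term_mx mulmx_coeffs_at //.
  apply/matrixP => r j; rewrite !mxE  /= eval_points_term pE; apply/eqP.
  rewrite eq_sym -subr_eq0; apply/eqP.
  rewrite -[RHS](Zx r _ (bc j)) mevalB; congr (_ - _).
  rewrite rmorph_sum; apply: eq_bigr => i _.
  by rewrite /= mevalZ !mxE pE mulrC.
have TD : \det (term_values p) != 0 by rewrite -eval_points_Delta.
pose X := MkClosed (ideal_of_points_ideal p).
exists X, (coeffs_at t b (eval_points p)); split=> //.
- move=> f k fk i; have /eqP := fk i.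
  by rewrite rmorphXn expf_eq0 => /andP[_ /eqP].
- by exists (fun j => 'X_[tnth t j]); apply: ideal_of_points_basis.
- exact: ideal_of_points_basis.
move=> j r; have /matrixP/(_ r j) := mulmx_coeffs_at b pD.
rewrite !mxE /= eval_points_term mevalB => <-; apply/eqP; rewrite subr_eq0.
apply/eqP; rewrite rmorph_sum; apply: eq_bigr => i _.
by rewrite /= mevalZ mulrC map_term_mx [term_values p r i]mxE.
Qed.

End Points.

(** * The kernel of Phi *)

Section Kernel.
Context (K : fieldType) (L : closedFieldType) (iota : {rmorphism K -> L}).
Context (n mu nu : nat).
Context (t : mu.-tuple 'X_{1..n}) (b : nu.-tuple 'X_{1..n}).
Hypothesis ut : uniq t.

Definition ker_Phi : set {mpoly K[mu * nu]} := [set f | Phi t b f = 0].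

Lemma ker_PhiP f :
  ker_Phi f <-> eval_at t b (@tofrac {mpoly K[mu * n]}) f = 0.
Proof.
split=> [/(congr1 val)|f0]; first exact.
by apply: val_inj.
Qed.

(** For the direct inclusion, [F] is expanded over a [K]-independent family and
    denominators are cleared; the resulting polynomial on [L]-points vanishes
    wherever [Delta] does not, so its product with [Delta] vanishes
    everywhere. Conversely, an element of the kernel has numerator zero, hence
    vanishes at every specialization. *)
Lemma reduced_points_vanishing (F : {mpoly L[mu * nu]}) :
  vanishing_ideal (reduced_points L t b) F <->
  ideal_gen (map_mpoly iota @` ker_Phi) F.
Proof.
have tofracD : tofrac (Delta K t) != 0 by rewrite tofrac_eq0 (Delta_neq0 iota).
split=> [F0|[r [a [g [gI ->]]]] q].
  have [r [e [ie _ FP]]] := independent_expansion iota [:: F].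
  have [f {FP}FE] := FP F (mem_head _ _).
  have [N [h hP]] := common_denominator t b f.
  suff h0 s : h s = 0.
    exists r, (fun s => (e s)%:MP), (fun s => map_mpoly iota (f s)).
    split=> [s|]; last first.
      by rewrite FE; apply: eq_bigr => s _; rewrite mul_mpolyC.
    exists (f s) => //; apply/ker_PhiP; rewrite (hP s _ _ tofracD) h0 rmorph0.
    by rewrite mul0r.
  move: s; apply: (independent_mpoly ie).
  have [p0 p0D] := exists_generic_points iota ut.
  (* Multiplication by Delta extends the vanishing to the points where the
     denominators are zero. *)
  have Dn0 : map_mpoly iota (Delta K t) != 0.
    by apply: contraNneq p0D => D0; rewrite eval_pointsE D0 meval0.
  apply: (mulfI Dn0); rewrite mulr0; apply: contrapT => /eqP.
  case/mpoly_nonzero_point=> v /eqP; apply; rewrite mevalM.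
  pose p : 'M[L]_(mu, n) := vec_mx (\row_s v s).
  have vE g : (map_mpoly iota g).@[v] = eval_points iota p g.
    by rewrite eval_pointsE; apply: meval_eq => s; rewrite vec_mxK mxE.
  rewrite vE; have [->|pD] := eqVneq (eval_points iota p (Delta K t)) 0.
    by rewrite mul0r.
  have := F0 (rational_point (coeffs_at t b (eval_points iota p))).
  have Sp : reduced_points L t b
      (rational_point (coeffs_at t b (eval_points iota p))).
    by apply/(reduced_pointsP iota); exists p.
  move=> /(_ Sp); rewrite /= FE !rmorph_sum /= => FE0.
  rewrite (_ : \sum_(s < r) _ = 0) ?mulr0 //.
  apply: (mulIf (expf_neq0 N (invr_neq0 pD))); rewrite mul0r -[RHS]FE0.
  rewrite mulr_suml; apply: eq_bigr => s _.
  rewrite !mevalZ -mulrA vE -eval_at_points (hP s _ _ pD).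
  by rewrite exprVn.
have /choice[g' g'P] : forall s, exists g',
    ker_Phi g' /\ map_mpoly iota g' = g s.
  by move=> s; have [g' Ig' <-] := gI s; exists g'.
move=> /(reduced_pointsP iota)[p pD ->] /=.
rewrite rmorph_sum big1 // => s _; rewrite /= mevalM -(g'P s).2.
rewrite -eval_at_points.
have [N [h hP]] := common_denominator t b g'.
have [/ker_PhiP] := g'P s; rewrite (hP _ _ _ tofracD) (hP _ _ _ pD) => /eqP.
rewrite mulf_eq0 invr_eq0 expf_eq0 (negbTE tofracD) andbF orbF tofrac_eq0.
by move=> /eqP -> _; rewrite rmorph0 mul0r mulr0.
Qed.

Lemma border_basis_scheme_ker :
  is_border t b -> def_ideal (border_basis_scheme K t b) `<=` ker_Phi.
Proof.
move=> bP f If; apply/ker_PhiP; apply: eval_at_border_basis_scheme If => //.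
by rewrite tofrac_eq0 (Delta_neq0 iota).
Qed.

End Kernel.

Section Generic.
Context (K : fieldType) (n mu nu : nat).
Context (t : mu.-tuple 'X_{1..n}) (b : nu.-tuple 'X_{1..n}).

Lemma zero_prime_CO : is_prime_ideal [set 0 : CO K t b].
Proof.
split=> [|/(congr1 val)/eqP|f g /(congr1 val)/eqP].
- split=> //= [f g -> ->|a f ->]; by rewrite ?addr0 ?mulr0.
- by rewrite rmorph1 oner_eq0.
- rewrite rmorphM rmorph0 mulf_eq0 => /orP[] /eqP f0; [left|right];
    by apply: val_inj; rewrite [RHS]rmorph0.
Qed.

Lemma ker_Phi_prime : is_prime_ideal (ker_Phi (K := K) t b).
Proof. exact: (preimage_prime (Phi t b) (MkSpec zero_prime_CO)). Qed.

(** The generic point of [Spec C_O] is mapped to the kernel of [Phi], and every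
    other point of the image contains this kernel. *)
Lemma vanishing_ideal_range_Phi :
  vanishing_ideal (range (spec_map (Phi t b))) = ker_Phi (K := K) t b.
Proof.
apply/seteqP; split=> [f fv|f f0 _ [p _ <-]].
  pose eta := MkSpec zero_prime_CO.
  by apply: (fv (spec_map (Phi t b) eta)); exists eta.
by rewrite /= /preimage /= f0; have [[]] := spec_idealP p.
Qed.

End Generic.

Theorem theorem3p6 (K : fieldType) (L : closedFieldType)
    (iota : {rmorphism K -> L}) (n mu nu : nat)
    (t : mu.-tuple 'X_{1..n}) (b : nu.-tuple 'X_{1..n}) :
  is_algebraic_closure iota ->
  is_order_ideal t ->
  is_border t b ->
  (exists C : closed_subscheme {mpoly K[mu * nu]},
     is_principal_component iota t b C) /\
  forall C : closed_subscheme {mpoly K[mu * nu]},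
    is_principal_component iota t b C ->
    (def_ideal C = [set f | Phi t b f = 0] /\
     vanishing_ideal (points C) = [set f | Phi t b f = 0]) /\
    (range (spec_map (Phi t b)) `<=` points (border_basis_scheme K t b) /\
     points C = closure (range (spec_map (Phi t b))) /\
     C = reduced_closure (range (spec_map (Phi t b)))) /\
    irreducible_set (points C).
Proof.
move=> _ [_ ut _] bP.
have kerP : is_prime_ideal (ker_Phi (K := K) t b) by apply: ker_Phi_prime.
have [iker _ _] := kerP.
have schemeI := border_basis_scheme_ker iota ut bP.
(* The principal component is the subscheme whose ideal has the same extension
   to [L[c_ij]] as the kernel. *)
have extE : ideal_gen (map_mpoly iota @` ker_Phi t b)
    = vanishing_ideal (reduced_points L t b).
  by apply/seteqP; split=> F /(reduced_points_vanishing iota b ut).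
split.
  exists (MkClosed iker); split; first exact: schemeI.
  by apply: closed_subscheme_eq; rewrite /= vanishing_ideal_closure extE.
move=> C [_ /(congr1 (@def_ideal _))].
rewrite /= vanishing_ideal_closure -extE => CE.
have {}CE : def_ideal C = ker_Phi t b.
  apply/seteqP; split=> f fC;
    apply: (ideal_gen_map_contract (iota := iota)) => //.
  - by rewrite -CE; apply: ideal_gen_mem; exists f.
  - exact: def_idealP.
  - by rewrite CE; apply: ideal_gen_mem; exists f.
have pC : points C = zero_locus (ker_Phi t b) by rewrite /points CE.
have clE : closure (range (spec_map (Phi t b)))
    = zero_locus (ker_Phi (K := K) t b).
  by rewrite closureE_zero_locus vanishing_ideal_range_Phi.
rewrite pC clE vanishing_zero_locus //; split=> //.
split; last exact: irreducible_zero_locus.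
split=> [q [p _ <-] f If|].
  by rewrite /= /preimage /= (schemeI _ If); have [[]] := spec_idealP p.
split=> //; apply: closed_subscheme_eq.
by rewrite /= vanishing_ideal_closure vanishing_ideal_range_Phi.
Qed.
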